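(* Let $\beta\ge1$ and let $0<q<1$ be fixed. For $\rho>1$ put $r=q\log\rho$. Then, as $\rho\to\infty$, $$\mathcal{E}_1(r)-\mathcal{E}_0\sim(1-q)(\beta-q)\log\rho ,$$ i.e. the ratio of the two sides tends to $1$.
   Context: An integrable function $p:\mathbb{R}_+\to\mathbb{R}$ is called tame if $\int_0^\infty x|p(x)|\,dx<\infty$ and there is some $\varepsilon>0$ with $\int_0^\infty|p(x)|^{1+\varepsilon}dx<\infty$. Let $\Omega$ be the set of tame functions. For $\beta\ge1$ and $p\in\Omega$ the energy functional is $$\mathcal{E}[p]=\int_0^\infty x\,p(x)\,dx-(\beta-1)\int_0^\infty p(x)\log x\,dx-\int_0^\infty\!\!\int_0^\infty p(x)p(y)\log|x-y|\,dx\,dy .$$ $\mathcal{X}=\{p\in\Omega: p\ge0,\ \int_0^\infty p(x)\,dx=1\}$ and, for given $\rho>0$ and $r>0$, $\mathcal{X}_r=\{p\in\mathcal{X}:\int_0^\infty p(x)\log(1+\rho x)\,dx=r\}$. Set $\mathcal{E}_0=\inf_{s\in\mathcal{X}}\mathcal{E}[s]$ and $\mathcal{E}_1(r)=\inf_{s\in\mathcal{X}_r}\mathcal{E}[s]$ (so $\mathcal{E}_1(r)$ also depends on $\rho$). Here $\log$ is the natural logarithm. *)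

(* Defs.v *)
From mathcomp Require Import all_boot all_order all_algebra.
From mathcomp Require Import all_classical all_reals all_analysis.
Set Implicit Arguments.
Unset Strict Implicit.
Unset Printing Implicit Defensive.
Import Order.TTheory GRing.Theory Num.Theory.
Import numFieldNormedType.Exports.
Local Open Scope classical_set_scope.
Local Open Scope ring_scope.

(* A function on the half-line is a total function R -> R of which only the
   values on Rplus are ever used. *)
Definition Rplus (R : realType) : set R := `[0, +oo[%classic.
Arguments Rplus : clear implicits.

Definition tame (R : realType) : set (R -> R) :=
  [set p | [/\ lebesgue_measure.-integrable (Rplus R) (EFin \o p),
    (\int[lebesgue_measure]_(x in Rplus R) (x * `|p x|)%:E < +oo)%E &
    exists2 eps : R, 0 < eps &
      (\int[lebesgue_measure]_(x in Rplus R) (`|p x| `^ (1 + eps))%:E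
        < +oo)%E]].
Arguments tame : clear implicits.

(* The integrands are integrable for tame p, so the real-valued integrals are
   the true ones. The library's ln vanishes at 0, which only affects null sets
   (x = 0 and, for each y, x = y). *)
Definition energy (R : realType) (beta : R) (p : R -> R) : R :=
  \int[lebesgue_measure]_(x in Rplus R) (x * p x)
  - (beta - 1) * \int[lebesgue_measure]_(x in Rplus R) (p x * ln x)
  - \int[lebesgue_measure]_(y in Rplus R)
      \int[lebesgue_measure]_(x in Rplus R) (p x * p y * ln `|x - y|).

Definition tame_density (R : realType) : set (R -> R) :=
  [set p | [/\ tame R p, forall x, 0 <= x -> 0 <= p x &
    \int[lebesgue_measure]_(x in Rplus R) p x = 1]].
Arguments tame_density : clear implicits.

Definition tame_density_at (R : realType) (rho r : R) : set (R -> R) :=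
  [set p | tame_density R p /\
    \int[lebesgue_measure]_(x in Rplus R) (p x * ln (1 + rho * x)) = r].

(* The infima are taken in the extended reals: the real-valued inf has a
   default value on sets that are empty or unbounded below. *)
Definition E0 (R : realType) (beta : R) : \bar R :=
  ereal_inf [set (energy beta p)%:E | p in tame_density R].

Definition E1 (R : realType) (beta rho r : R) : \bar R :=
  ereal_inf [set (energy beta p)%:E | p in tame_density_at rho r].

(* Main.v *)
Require Import Defs.
From mathcomp Require Import all_boot all_order all_algebra.
From mathcomp Require Import all_classical all_reals all_analysis.
From mathcomp Require Import measurable_realfun lra.
Import Order.TTheory GRing.Theory Num.Theory.
Import numFieldNormedType.Exports.
Local Open Scope classical_set_scope.
Local Open Scope ring_scope.

(* Since E_0 is a finite constant, it suffices to show
   E_1 = (1 - q) (beta - q) L + O(1), where L = log rho.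
   Lower bound: log x <= log (1 + rho x) - L turns the constraint into
   int p log x <= (q - 1) L, which gives the (beta - 1) (1 - q) L part. For the
   interaction, |x - y| <= max x y, so with u = log (1 + rho x) and
   v = min u L one has log |x - y| <= u(x) + u(y) - L - v(x) v(y) / L. After
   integration the product term is q^2 L up to an error absorbed by int x p, and
   (1 - q)^2 L remains.
   Upper bound: put mass a at scale 1 and mass 1 - a at scale 1 / rho, both
   uniform, with a chosen to meet the constraint; then a = q + O(1 / L).
   Integrability of the logarithmic kernel against a tame density comes from
   Young's inequality and the local integrability of |x - y|^(-1/2). *)

(** * The singular kernel |x - y|^(-1/2) *)

Definition invsqrt {R : realType} (y x : R) : R := (Num.sqrt `|x - y|)^-1.

Lemma invsqrt_ge0 {R : realType} (y x : R) : 0 <= invsqrt y x.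
Proof. by rewrite invr_ge0 sqrtr_ge0. Qed.

Lemma measurable_invsqrt {R : realType} (D : set R) (y : R) :
  measurable_fun D (invsqrt y).
Proof.
apply: measurable_funTS.
have -> : invsqrt y = fun x => `|x - y| `^ (- 2^-1).
  by apply/funext => x; rewrite powRN powR12_sqrt.
apply: (@measurableT_comp _ _ _ _ _ _ (fun z : R => z `^ (- 2^-1))) => //.
apply: measurableT_comp => //.
exact: measurable_funB.
Qed.

Lemma continuous_invsqrt {R : realType} (y : R) (A : set R) : ~ A y ->
  {within A, continuous (invsqrt y)}.
Proof.
move=> Ay; apply: continuous_in_subspaceT => x; rewrite inE => Ax.
have xy0 : x - y != 0.
  by rewrite subr_eq0; apply/eqP => xy; apply: Ay; rewrite -xy.
apply: cvgV; first by rewrite sqrtr_eq0 -ltNge normr_gt0.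
apply: (@continuous_comp _ _ _ (fun z : R => `|z - y|) Num.sqrt).
  by apply: cvg_norm; apply: cvgB; [exact: cvg_id|exact: cvg_cst].
exact: sqrt_continuous.
Qed.

(** The cut-off [e] keeps the interval away from the singularity, so the fundamental theorem applies
    with antiderivative [2 * sqrt (x - y)]. The bound is independent of [e], which allows [e] to
    tend to 0. *)
Lemma integral_invsqrt_right {R : realType} (y e h : R) : 0 < e ->
  (\int[lebesgue_measure]_(x in `[(y + e)%R, (y + h)%R]) (invsqrt y x)%:E
   <= (2 * Num.sqrt h)%:E)%E.
Proof.
move=> e0; have [eh|he] := ltP e h; last first.
  apply: (@le_trans _ _ 0%E); last by rewrite lee_fin mulr_ge0// sqrtr_ge0.
  move: he; rewrite le_eqVlt => /predU1P[->|he].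
    by rewrite set_itv1 integral_set1.
  by rewrite set_itv_ge ?integral_set0// bnd_simp -ltNge ltrD2l.
pose F x := 2 * Num.sqrt (x - y) : R.
have dF x : y < x -> is_derive x 1 F (invsqrt y x).
  move=> yx; have xy0 : 0 < x - y by rewrite subr_gt0.
  have ds : is_derive (x - y) 1 Num.sqrt (2 * Num.sqrt (x - y))^-1.
    exact: is_derive1_sqrt.
  have d1 : is_derive x 1 (fun z : R => z - y) 1.
    by apply: is_derive_eq; rewrite subr0.
  have := @is_derive1_comp R Num.sqrt (fun z : R => z - y) x _ _ ds d1.
  rewrite mulr1 => d2.
  have -> : invsqrt y x = 2 *: (2 * Num.sqrt (x - y))^-1.
    by rewrite /invsqrt gtr0_norm// /GRing.scale /= invfM mulrA divff ?mul1r.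
  exact: is_deriveZ.
rewrite (@continuous_FTC2 _ _ F)//.
- rewrite -EFinB lee_fin /F !(addrC y) !addrK.
  by rewrite gerBl mulr_ge0// sqrtr_ge0.
- by rewrite ltrD2l.
- apply: continuous_invsqrt; rewrite /= in_itv/= => /andP[].
  by rewrite gerDl leNgt e0.
- split.
  + move=> x; rewrite in_itv/= => /andP[yx _].
    by case: (dF x); first lra.
  + apply: cvg_at_right_filter; apply: differentiable_continuous.
    by apply/derivable1_diffP; case: (dF (y + e)); first lra.
  + apply: cvg_at_left_filter; apply: differentiable_continuous.
    by apply/derivable1_diffP; case: (dF (y + h)); first lra.
- move=> x; rewrite in_itv/= => /andP[yx _].
  rewrite derive1E; apply: derive_val.
  by apply: dF; lra.
Qed.

(** The reflection [x -> - x] reduces this to the right-hand side of the point [- y]. *)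
Lemma integral_invsqrt_left {R : realType} (y e h : R) : 0 < e ->
  (\int[lebesgue_measure]_(x in `[(y - h)%R, (y - e)%R]) (invsqrt y x)%:E
   <= (2 * Num.sqrt h)%:E)%E.
Proof.
move=> e0; have [eh|he] := ltP e h; last first.
  apply: (@le_trans _ _ 0%E); last by rewrite lee_fin mulr_ge0// sqrtr_ge0.
  move: he; rewrite le_eqVlt => /predU1P[->|he].
    by rewrite set_itv1 integral_set1.
  by rewrite set_itv_ge ?integral_set0// bnd_simp -ltNge ltrD2l ltrN2.
have -> : y - h = - (- y + h) by rewrite opprD opprK.
have -> : y - e = - (- y + e) by rewrite opprD opprK.
rewrite integration_by_substitution_oppr; last 2 first.
- by rewrite lerD2l ltW.
- apply: continuous_invsqrt; rewrite /= in_itv/= => /andP[_].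
  by rewrite opprD opprK leNgt ltrBlDr ltrDl e0.
apply: le_trans (integral_invsqrt_right (- y) e h e0).
rewrite le_eqVlt; apply/orP; left; apply/eqP; apply: eq_integral => x _.
by rewrite /= /invsqrt opprK -normrN opprB opprK addrC.
Qed.

(** The punctured ball is the increasing union of the sets [F n], cut off at distance [1/(n+1)] on
    both sides of [y]. Monotone convergence transfers the uniform one-sided bounds to the limit. *)
Lemma integral_invsqrt_ball {R : realType} (y h : R) :
  (\int[lebesgue_measure]_(x in `[(y - h)%R, (y + h)%R]) (invsqrt y x)%:E
   <= (4 * Num.sqrt h)%:E)%E.
Proof.
have mf (A : set R) : measurable_fun A (EFin \o invsqrt y).
  by apply/measurable_EFinP; exact: measurable_invsqrt.
have f0 x : (0 <= (EFin \o invsqrt y) x)%E by rewrite lee_fin invsqrt_ge0.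
pose F (n : nat) : set R := `[(y - h)%R, (y - n.+1%:R^-1)%R]%classic
   `|` `[(y + n.+1%:R^-1)%R, (y + h)%R]%classic.
rewrite -(@integral_setD1 _ _ y)//; last by apply: measurableD.
have -> : `[y - h, y + h]%classic `\ y = \bigcup_n F n.
  apply/seteqP; split => x /=.
    rewrite in_itv/= => -[/andP[xh xh'] /eqP xy].
    have xy0 : 0 < `|x - y| by rewrite normr_gt0 subr_eq0.
    exists (Num.truncn `|x - y|^-1) => //=; rewrite /F/= !in_itv/= xh xh' andbT/=.
    have : (Num.truncn `|x - y|^-1).+1%:R^-1 <= `|x - y|.
      rewrite -[leRHS]invrK lef_pV2 ?posrE ?invr_gt0//.
      by apply/ltW/truncnS_gt.
    move: (_.+1%:R^-1) => e; rewrite ler_normr => /orP[] ?; [right|left]; lra.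
  move=> [n _]; rewrite /F/= !in_itv/=.
  have : 0 < n.+1%:R^-1 :> R by rewrite invr_gt0.
  move: (n.+1%:R^-1) => e e0 xe.
  by case: xe => /andP[? ?]; split; try (apply/andP; split); try move=> ?; lra.
have ndF : nondecreasing_seq F.
  move=> m n mn; rewrite subsetEset => x; rewrite /F/= !in_itv/=.
  have : n.+1%:R^-1 <= m.+1%:R^-1 :> R by rewrite lef_pV2 ?posrE// ler_nat ltnS.
  move: (n.+1%:R^-1) (m.+1%:R^-1) => e e' ee' [|] /andP[? ?]; [left|right];
    by apply/andP; split; lra.
have mF i : measurable (F i) by exact: measurableU.
have cvgF := @ge0_nondecreasing_set_cvg_integral _ (measurableTypeR R) R F
  (EFin \o invsqrt y) (@lebesgue_measure R) ndF mF (fun i => mf _)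
  (fun i x _ => f0 x).
rewrite -(cvg_lim _ cvgF)//; apply: lime_le.
  by apply/cvg_ex; eexists; exact: cvgF.
apply: nearW => n.
have dF : [disjoint `[(y - h)%R, (y - n.+1%:R^-1)%R]%classic
                  & `[(y + n.+1%:R^-1)%R, (y + h)%R]%classic].
  rewrite disj_set2E; apply/eqP/seteqP; split => x //=; rewrite !in_itv/=.
  have : 0 < n.+1%:R^-1 :> R by rewrite invr_gt0.
  by move: (n.+1%:R^-1) => e e0 [/andP[? ?] /andP[? ?]]; lra.
rewrite (@ge0_integral_setU _ (measurableTypeR R) R (@lebesgue_measure R) _ _
  (measurable_itv _) (measurable_itv _) _ (mf _) (fun x _ => f0 x) dF).
have -> : 4 * Num.sqrt h = 2 * Num.sqrt h + 2 * Num.sqrt h by lra.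
by rewrite EFinD; apply: leeD; [apply: integral_invsqrt_left|
  apply: integral_invsqrt_right]; rewrite invr_gt0.
Qed.

(** * Weighted integrals on the half-line *)

Lemma measurable_Rplus {R : realType} :
  measurable (Rplus R : set (measurableTypeR R)).
Proof. exact: measurable_itv. Qed.

Lemma RplusP {R : realType} (x : R) : Rplus R x <-> 0 <= x.
Proof. by rewrite /Rplus /= in_itv/= andbT. Qed.

(** This is [ln z <= z] at [z = sqrt (d / t)]. At [t = 0] the default values [ln 0 = 0] and
    [0^-1 = 0] reduce it to [ln d <= 0], which is where [d <= 1] enters. *)
Lemma ln_norm_ge {R : realType} (d t : R) : 0 < d <= 1 -> 0 <= t ->
  ln d - 2 * Num.sqrt d * (Num.sqrt t)^-1 <= ln t.
Proof.
move=> /andP[d0 d1]; rewrite le_eqVlt => /predU1P[<-|t0].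
  by rewrite sqrtr0 invr0 mulr0 subr0 [leRHS]ln0// ln_le0.
have sd : 0 < Num.sqrt d by rewrite sqrtr_gt0.
have st : 0 < Num.sqrt t by rewrite sqrtr_gt0.
have := ln_sublinear (divr_gt0 sd st).
rewrite ln_div ?posrE// -[X in ln X - _ <= _](sqr_sqrtr (ltW d0)).
rewrite -[X in _ <= ln X](sqr_sqrtr (ltW t0)) !lnXn// !mulr2n -mulrA.
lra.
Qed.

(* Young's inequality with exponents 1 + e and s = 1 + 1/e, followed by
   - ln t <= 2 s t^(-1/(2s)). *)
Lemma mul_ln_le {R : realType} (e : R) : 0 < e ->
  exists2 C : R, 0 <= C & forall a t : R, 0 <= a -> 0 <= t ->
    a * `|ln t| <= a * t + a `^ (1 + e)
                   + C * ((t <= 1)%R%:R * (Num.sqrt t)^-1).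
Proof.
move=> e0; pose s := (1 + e) / e.
have s0 : 0 < s by rewrite divr_gt0// addr_gt0.
have s1 : 1 <= s by rewrite ler_pdivlMr// mul1r; lra.
exists ((2 * s) `^ s) => [|a t a0]; first exact: powR_ge0.
have pe0 : 0 <= a `^ (1 + e) by exact: powR_ge0.
have C0 : 0 <= (2 * s) `^ s by exact: powR_ge0.
rewrite le_eqVlt => /predU1P[<-|t0].
  by rewrite ln0// normr0 mulr0 sqrtr0 invr0 !mulr0 addr0 add0r.
(* Beyond 1 the indicator vanishes and [ln t <= t] is enough; Young's inequality serves the range
   [t <= 1]. *)
have [t1|t1] := leP t 1; last first.
  rewrite mul0r mulr0 addr0 (ger0_norm (ln_ge0 (ltW t1))).
  apply: (@le_trans _ _ (a * t)); last by rewrite lerDl.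
  by rewrite ler_wpM2l// ltW// ln_sublinear.
rewrite mul1r ler0_norm ?ln_le0//.
have b0 : 0 <= - ln t by rewrite oppr_ge0 ln_le0.
have e1 : 0 < 1 + e by rewrite addr_gt0.
have st0 : 0 < 2 * s by rewrite mulr_gt0.
have := @conjugate_powR R a (- ln t) (1 + e) s a0 b0 e1 s0.
have -> : (1 + e)^-1 + s^-1 = 1.
  by rewrite /s invf_div -{1}(mul1r (1 + e)^-1) -mulrDl divff// gt_eqF.
move=> /(_ erefl) /le_trans; apply.
have hb : - ln t <= (2 * s) * t `^ (- (2 * s)^-1).
  have := ln_sublinear (powR_gt0 (- (2 * s)^-1) t0).
  rewrite ln_powR => /ltW/(ler_wpM2l (ltW st0)).
  by rewrite mulNr mulrN mulrA divff ?mul1r// gt_eqF.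
have hb2 : (- ln t) `^ s <= (2 * s) `^ s * (Num.sqrt t)^-1.
  have -> : (Num.sqrt t)^-1 = (t `^ (- (2 * s)^-1)) `^ s.
    rewrite -powRrM mulNr invfM -mulrA mulVf ?gt_eqF// mulr1.
    by rewrite powRN powR12_sqrt// ltW.
  rewrite -(@powRM _ _ _ _ (ltW st0) (powR_ge0 _ _)).
  apply: (ge0_ler_powR (ltW s0)); rewrite ?nnegrE//.
  by rewrite mulr_ge0 ?powR_ge0// (ltW st0).
have h1 : a `^ (1 + e) / (1 + e) <= a `^ (1 + e).
  by rewrite ler_pdivrMr// ler_peMr//; lra.
have h2 : (- ln t) `^ s / s <= (- ln t) `^ s.
  by rewrite ler_pdivrMr// ler_peMr// powR_ge0.
have at0 : 0 <= a * t by rewrite mulr_ge0// ltW.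
lra.
Qed.

(** * Means against a density and their comparison *)

Definition mean {R : realType} (p f : R -> R) : R :=
  \int[lebesgue_measure]_(x in Rplus R) (p x * f x).

Definition has_mean {R : realType} (p f : R -> R) :=
  lebesgue_measure.-integrable (Rplus R) (EFin \o (fun x => p x * f x)).

Lemma meanD {R : realType} (p f g : R -> R) : has_mean p f -> has_mean p g ->
  mean p (fun x => f x + g x) = mean p f + mean p g.
Proof.
move=> pf pg; rewrite /mean -RintegralD//; last exact: measurable_Rplus.
by apply: eq_Rintegral => x _; rewrite mulrDr.
Qed.

Lemma has_meanD {R : realType} (p f g : R -> R) :
  has_mean p f -> has_mean p g -> has_mean p (fun x => f x + g x).
Proof.
move=> pf pg; have := integrableD measurable_Rplus pf pg.
by apply: eq_integrable; [exact: measurable_Rplus|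
  move=> x _ /=; rewrite mulrDr EFinD].
Qed.

Lemma meanZ {R : realType} (p f : R -> R) (c : R) : has_mean p f ->
  mean p (fun x => c * f x) = c * mean p f.
Proof.
move=> pf; rewrite /mean -RintegralZl//; last exact: measurable_Rplus.
by apply: eq_Rintegral => x _; rewrite mulrCA.
Qed.

Lemma has_meanZ {R : realType} (p f : R -> R) (c : R) :
  has_mean p f -> has_mean p (fun x => c * f x).
Proof.
move=> pf; have := integrableZl measurable_Rplus c pf.
by apply: eq_integrable; [exact: measurable_Rplus|
  move=> x _ /=; rewrite mulrCA EFinM].
Qed.

(** One point [y] may be left out, being a null set: for the kernel [ln |x - y|] the default
    [ln 0 = 0] can break a pointwise bound on the diagonal. *)
Lemma mean_le {R : realType} (y : R) (p f g : R -> R) :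
  (forall x, 0 <= x -> 0 <= p x) -> has_mean p f -> has_mean p g ->
  (forall x, 0 <= x -> 0 < p x -> x != y -> f x <= g x) ->
  mean p f <= mean p g.
Proof.
move=> p0 pf pg fg.
have mD : measurable (Rplus R `\ y).
  by apply: measurableD; first exact: measurable_Rplus.
have sD : Rplus R `\ y `<=` Rplus R by move=> x [].
have iD h : has_mean p h -> lebesgue_measure.-integrable (Rplus R `\ y)
    (EFin \o (fun x => p x * h x)).
  by apply: integrableS => //; exact: measurable_Rplus.
have E h : has_mean p h ->
    mean p h = \int[lebesgue_measure]_(x in Rplus R `\ y) (p x * h x).
  move=> ph; rewrite /mean /Rintegral -(@integral_setD1 _ _ y)//.
  exact: measurable_int (iD _ ph).
rewrite !E//; apply: le_Rintegral => //; [exact: iD|exact: iD|].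
move=> x [/RplusP x0 /eqP xy].
have := p0 _ x0; rewrite le_eqVlt => /predU1P[<-|px]; first by rewrite !mul0r.
by rewrite ler_wpM2l ?(ltW px)// fg.
Qed.

Lemma has_mean_le {R : realType} (p f g : R -> R) :
  measurable_fun (Rplus R) p -> measurable_fun (Rplus R) f ->
  lebesgue_measure.-integrable (Rplus R) (EFin \o g) ->
  (forall x, 0 <= x -> `|p x * f x| <= g x) -> has_mean p f.
Proof.
move=> mp mf ig fg; apply: le_integrable ig; first exact: measurable_Rplus.
  by apply/measurable_EFinP; exact: measurable_funM.
move=> x /RplusP x0 /=; rewrite lee_fin (le_trans (fg _ x0))//.
exact: ler_norm.
Qed.

Lemma has_mean_lin {R : realType} (c : R) (p f : R -> R) :
  has_mean p (cst 1) -> has_mean p id -> measurable_fun (Rplus R) f ->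
  (forall x, 0 <= x -> 0 <= p x) ->
  (forall x, 0 <= x -> `|f x| <= c * (1 + x)) -> has_mean p f.
Proof.
move=> p1 pid mf p0 hf.
apply: (@has_mean_le _ _ _ (fun x => p x * (c * (cst 1 x + id x)))) => //.
- have := measurable_int _ p1; move/measurable_EFinP; apply: eq_measurable_fun.
  by move=> x _ /=; rewrite mulr1.
- by apply: has_meanZ; apply: has_meanD.
- by move=> x x0; rewrite normrM ger0_norm ?p0// ler_wpM2l ?p0// hf.
Qed.

(** * The logarithmic potential of a tame density *)

Lemma tame_density_ge0 {R : realType} (p : R -> R) : tame_density R p ->
  forall x, 0 <= x -> 0 <= p x.
Proof. by case. Qed.

Lemma tame_density_integrable {R : realType} (p : R -> R) :
  tame_density R p -> lebesgue_measure.-integrable (Rplus R) (EFin \o p).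
Proof. by case=> -[]. Qed.

Lemma tame_density_measurable {R : realType} (p : R -> R) :
  tame_density R p -> measurable_fun (Rplus R) p.
Proof.
by move=> /tame_density_integrable /measurable_int /measurable_EFinP.
Qed.

Lemma has_mean_cst {R : realType} (p : R -> R) (c : R) :
  tame_density R p -> has_mean p (cst c).
Proof.
move=> /tame_density_integrable ip.
have := integrableZl measurable_Rplus c ip.
apply: eq_integrable; first exact: measurable_Rplus.
by move=> x _ /=; rewrite -EFinM mulrC.
Qed.

Lemma mean_cst {R : realType} (p : R -> R) (c : R) :
  tame_density R p -> mean p (cst c) = c.
Proof.
move=> pd; rewrite /mean RintegralZr//; last exact: tame_density_integrable.
- by case: pd => _ _ ->; rewrite mul1r.
- exact: measurable_Rplus.
Qed.

Lemma has_mean_id {R : realType} (p : R -> R) :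
  tame_density R p -> has_mean p id.
Proof.
move=> pd; apply/integrableP; split.
  apply/measurable_EFinP; apply: measurable_funM => //.
  exact: tame_density_measurable.
case: pd => -[_ h _] p0 _; apply: le_lt_trans h.
rewrite le_eqVlt; apply/orP; left; apply/eqP; apply: eq_integral => x.
rewrite inE => /RplusP x0 /=.
by rewrite normrM (ger0_norm x0) mulrC.
Qed.

Lemma has_mean_tame {R : realType} (c : R) (p f : R -> R) :
  tame_density R p -> measurable_fun (Rplus R) f ->
  (forall x, 0 <= x -> `|f x| <= c * (1 + x)) -> has_mean p f.
Proof.
move=> pd mf; apply: has_mean_lin => //.
- exact: has_mean_cst.
- exact: has_mean_id.
- exact: tame_density_ge0.
Qed.

(** Truncation to distance [h] makes the integral over the half-line bounded uniformly in [y], by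
    [4 * sqrt h]. *)
Definition local_invsqrt {R : realType} (h y x : R) : R :=
  (`|x - y| <= h)%R%:R * invsqrt y x.

Lemma local_invsqrt_ge0 {R : realType} (h y x : R) : 0 <= local_invsqrt h y x.
Proof. by rewrite mulr_ge0// invsqrt_ge0. Qed.

Lemma local_invsqrtE {R : realType} (h y : R) :
  EFin \o local_invsqrt h y =
  (EFin \o invsqrt y) \_ `[(y - h)%R, (y + h)%R]%classic.
Proof.
apply/funext => x; rewrite /patch /= /local_invsqrt ler_norml.
have -> : (x \in `[(y - h)%R, (y + h)%R]%classic) = (- h <= x - y <= h).
  apply/idP/idP; rewrite inE /= in_itv/=.
    by move=> /andP[? ?]; apply/andP; split; lra.
  by move=> /andP[? ?]; apply/andP; split; lra.
by case: ifP => _; rewrite ?mul1r ?mul0r.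
Qed.

Lemma measurable_local_invsqrt {R : realType} (D : set R) (h y : R) :
  measurable_fun D (local_invsqrt h y).
Proof.
apply: measurable_funTS; apply/measurable_EFinP; rewrite local_invsqrtE.
apply/(measurable_restrictT _ _).1 => //.
by apply/measurable_EFinP; exact: measurable_invsqrt.
Qed.

Lemma integral_local_invsqrt {R : realType} (h y : R) :
  (\int[lebesgue_measure]_(x in Rplus R) (local_invsqrt h y x)%:E
    <= (4 * Num.sqrt h)%:E)%E.
Proof.
apply: le_trans (integral_invsqrt_ball y h).
rewrite [leRHS]integral_mkcond -local_invsqrtE.
apply: ge0_subset_integral => //; first exact: measurable_Rplus.
- by apply/measurable_EFinP; exact: measurable_local_invsqrt.
- by move=> x _; rewrite lee_fin local_invsqrt_ge0.
Qed.

Lemma integrable_local_invsqrt {R : realType} (h y : R) :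
  lebesgue_measure.-integrable (Rplus R) (EFin \o local_invsqrt h y).
Proof.
apply/integrableP; split.
  by apply/measurable_EFinP; exact: measurable_local_invsqrt.
apply: le_lt_trans (ltry (4 * Num.sqrt h)).
apply: le_trans (integral_local_invsqrt h y).
rewrite le_eqVlt; apply/orP; left; apply/eqP; apply: eq_integral => x _.
by rewrite /= ger0_norm// local_invsqrt_ge0.
Qed.

Lemma Rintegral_local_invsqrt {R : realType} (h y : R) :
  \int[lebesgue_measure]_(x in Rplus R) (local_invsqrt h y x)
    <= 4 * Num.sqrt h.
Proof.
have /integrable_fin_num fi := integrable_local_invsqrt h y.
rewrite -lee_fin /Rintegral fineK ?fi//; first exact: integral_local_invsqrt.
exact: measurable_Rplus.
Qed.

Lemma measurable_ln_norm {R : realType} (D : set R) (y : R) :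
  measurable_fun D (fun x => ln `|x - y|).
Proof.
apply: measurable_funTS.
apply: (@measurableT_comp _ _ _ _ _ _ (@ln R)); first exact: measurable_ln.
by apply: measurableT_comp => //; exact: measurable_funB.
Qed.

(** [mul_ln_le] with [a = p x] and [t = |x - y|] bounds the integrand by three terms, controlled by
    the first moment, the [L^(1+e)] condition and the truncated kernel. Since [|x - y| <= x + y],
    the growth in [y] is only linear, so the bound can be integrated against [p] once more. *)
Lemma norm_kernel_mean {R : realType} (p : R -> R) : tame_density R p ->
  exists2 K : R, 0 <= K & forall y, 0 <= y ->
    has_mean p (fun x => `|ln `|x - y| |) /\
    mean p (fun x => `|ln `|x - y| |) <= K * (1 + y).
Proof.
move=> pd; have [[_ _ [e e0 pe]] p0 _] := pd.
have mp := tame_density_measurable _ pd.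
have [C C0 hC] := mul_ln_le _ e0.
pose P x := `|p x| `^ (1 + e).
have mP : measurable_fun (Rplus R) P.
  apply: (@measurableT_comp _ _ _ _ _ _ (fun z : R => z `^ (1 + e))) => //.
  exact: measurableT_comp.
have iP : lebesgue_measure.-integrable (Rplus R) (EFin \o P).
  apply/integrableP; split; first exact/measurable_EFinP.
  apply: le_lt_trans pe; rewrite le_eqVlt; apply/orP; left; apply/eqP.
  by apply: eq_integral => x _ /=; rewrite ger0_norm// powR_ge0.
have [iid i1] := (has_mean_id _ pd, has_mean_cst _ 1 pd).
pose J : R := \int[lebesgue_measure]_(x in Rplus R) P x.
have J0 : 0 <= J by apply: Rintegral_ge0 => x _; exact: powR_ge0.
have m0 : 0 <= mean p id.
  by apply: Rintegral_ge0 => x /RplusP x0; rewrite mulr_ge0 ?p0.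
exists (1 + mean p id + J + 4 * C); first by rewrite !addr_ge0// mulr_ge0.
move=> y y0.
pose g x := p x * (id x + y * cst 1 x)
  + (P x + C * local_invsqrt 1 y x).
have i1y := has_meanD _ _ _ iid (has_meanZ _ _ y i1).
have iC : lebesgue_measure.-integrable (Rplus R)
    (EFin \o (fun x => C * local_invsqrt 1 y x)).
  exact: (integrableZl measurable_Rplus C (integrable_local_invsqrt 1 y)).
have iPC : lebesgue_measure.-integrable (Rplus R)
    (EFin \o (fun x => P x + C * local_invsqrt 1 y x)).
  exact: (integrableD measurable_Rplus iP iC).
have ig : lebesgue_measure.-integrable (Rplus R) (EFin \o g).
  exact: (integrableD measurable_Rplus i1y iPC).
have le x : 0 <= x -> p x * `|ln `|x - y| | <= g x.
  move=> x0; have px := p0 _ x0.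
  apply: le_trans (hC _ _ px (normr_ge0 (x - y))) _.
  rewrite /g /P (ger0_norm px) addrA !lerD2r ler_wpM2l//= mulr1.
  by rewrite (le_trans (ler_normB _ _))// !ger0_norm.
have hm : has_mean p (fun x => `|ln `|x - y| |).
  apply: (has_mean_le _ _ g) => //.
    by apply: measurableT_comp => //; exact: measurable_ln_norm.
  by move=> x x0; rewrite normrM normr_id ger0_norm ?p0//; exact: le.
split => //.
apply: (@le_trans _ _ (\int[lebesgue_measure]_(x in Rplus R) g x)).
  apply: le_Rintegral => //; first exact: measurable_Rplus.
  by move=> x /RplusP; exact: le.
rewrite /g RintegralD//; last exact: measurable_Rplus.
rewrite [X in X + _ <= _](meanD _ _ _ iid (has_meanZ _ _ y i1)).
rewrite meanZ// (mean_cst _ 1 pd) mulr1.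
rewrite RintegralD//; last exact: measurable_Rplus.
rewrite RintegralZl//; last 2 first.
- exact: measurable_Rplus.
- exact: integrable_local_invsqrt.
have h4 := ler_wpM2l C0 (Rintegral_local_invsqrt 1 y).
rewrite sqrtr1 mulr1 in h4; rewrite -/J mulrDr mulr1.
have : 0 <= (mean p id + J + 4 * C) * y.
  by rewrite !mulr_ge0// !addr_ge0// mulr_ge0.
lra.
Qed.

(** The logarithmic potential without the customary minus sign. Its value at 0 is the integral of
    [p x * ln x], so it also expresses the external term of the energy. *)
Definition potential {R : realType} (p : R -> R) (y : R) : R :=
  mean p (fun x => ln `|x - y|).

Lemma has_mean_kernel {R : realType} (p : R -> R) (y : R) :
  tame_density R p -> 0 <= y -> has_mean p (fun x => ln `|x - y|).
Proof.
move=> pd y0; have [K K0 hK] := norm_kernel_mean _ pd.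
have [i _] := hK _ y0.
apply: has_mean_le i _ => //.
- exact: tame_density_measurable.
- exact: measurable_ln_norm.
- by move=> x x0; rewrite normrM ger0_norm// (tame_density_ge0 _ pd).
Qed.

(* The kernel p x * p y * ln |x - y| is integrable on the product, so Fubini's
   theorem yields the measurability of the potential. *)
Lemma has_mean_potential {R : realType} (p : R -> R) :
  tame_density R p -> has_mean p (potential p).
Proof.
move=> pd; have [K K0 hK] := norm_kernel_mean _ pd.
have p0 := tame_density_ge0 _ pd.
have mp := tame_density_measurable _ pd.
pose mu := @lebesgue_measure R.
(* Extension by zero puts the kernel on the whole plane, where Tonelli and Fubini are applied. *)
pose P : measurableTypeR R -> R := p \_ (Rplus R).
have mP : measurable_fun setT P.
  by apply/(measurable_restrictT _ _).1 => //; exact: measurable_Rplus.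
pose k (z : measurableTypeR R * measurableTypeR R) : R :=
  P z.2 * P z.1 * ln `|z.2 - z.1|.
have mk : measurable_fun setT k.
  apply: measurable_funM.
    by apply: measurable_funM; apply: measurableT_comp => //.
  apply: (@measurableT_comp _ _ _ _ _ _ (@ln R)); first exact: measurable_ln.
  by apply: measurableT_comp => //; exact: measurable_funB.
have PE x : 0 <= x -> P x = p x.
  by move=> x0; rewrite /P patchE mem_set//; apply/RplusP.
have PN x : ~ Rplus R x -> P x = 0.
  by move=> x0; rewrite /P patchE memNset.
have absE y : 0 <= y -> (\int[mu]_x `|(k (y, x))%:E|
    = (p y * mean p (fun x => `|ln `|x - y| |))%:E)%E.
  move=> y0; have [i _] := hK _ y0.
  have /integrable_fin_num fi := i.
  rewrite EFinM /mean /Rintegral fineK; last exact: (fi measurable_Rplus).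
  rewrite -integralZl//; last exact: measurable_Rplus.
  rewrite [RHS]integral_mkcond; apply: eq_integral => x _.
  rewrite patchE; case: ifPn => [|/negP]; rewrite inE => xD.
    have /RplusP x0 := xD.
    rewrite /k /= !PE// !normrM (ger0_norm (p0 _ x0)) (ger0_norm (p0 _ y0)).
    by congr EFin; rewrite -mulrA mulrCA.
  by rewrite /k /= PN// !mul0r normr0.
(* Tonelli: the inner integral of [|k|] is at most [K * p y * (1 + y)], which is integrable because
   [p] has a first moment. *)
have ik : (mu \x mu)%E.-integrable setT (EFin \o k).
  apply/integrable12ltyP; first exact/measurable_EFinP.
  have iB : lebesgue_measure.-integrable (Rplus R)
      (EFin \o (fun y => p y * (K * (cst 1 y + id y)))).
    apply: has_meanZ; apply: has_meanD; last exact: has_mean_id.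
    exact: has_mean_cst.
  have /integrableP[mB] := iB; apply: le_lt_trans.
  rewrite [leRHS]integral_mkcond; apply: ge0_le_integral => //.
  - by move=> y _; exact: integral_ge0.
  - apply: (measurable_fun_fubini_tonelli_F (fun z => `|(k z)%:E|%E)) => //.
    by apply: measurableT_comp => //; exact/measurable_EFinP.
  - apply/(measurable_restrictT _ _).1; first exact: measurable_Rplus.
    exact: measurableT_comp.
  - move=> y _; rewrite patchE; case: ifPn => [|/negP]; rewrite inE => yD.
      have /RplusP y0 := yD.
      rewrite absE//= lee_fin (le_trans _ (ler_norm _))//.
      by rewrite ler_wpM2l ?p0//; case: (hK _ y0).
    rewrite le_eqVlt; apply/orP; left; apply/eqP; apply: integral0_eq => x _.
    by rewrite /k /= (PN y)// mulr0 mul0r normr0.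
have iG := integrable_fubini_F ik.
have : lebesgue_measure.-integrable (Rplus R) (fubini_F mu (EFin \o k)).
  by apply: integrableS iG => //; exact: measurable_Rplus.
apply: eq_integrable; first exact: measurable_Rplus.
move=> y; rewrite inE => yD; have /RplusP y0 := yD.
have i := has_mean_kernel _ _ pd y0.
have /integrable_fin_num fi := i.
rewrite /= EFinM /potential /mean /Rintegral fineK; last exact: (fi measurable_Rplus).
rewrite -integralZl//; last exact: measurable_Rplus.
rewrite /fubini_F [RHS]integral_mkcond; apply: eq_integral => x _.
rewrite patchE; case: ifPn => [|/negP]; rewrite inE => xD.
  have /RplusP x0 := xD.
  by rewrite /k /= !PE//; congr EFin; rewrite -mulrA mulrCA.
by rewrite /k /= PN// !mul0r.
Qed.

Lemma energyE {R : realType} (beta : R) (p : R -> R) : tame_density R p ->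
  energy beta p
  = mean p id - (beta - 1) * potential p 0 - mean p (potential p).
Proof.
move=> pd; rewrite /energy; congr (_ - _ * _ - _).
- by apply: eq_Rintegral => x _; rewrite mulrC.
- apply: eq_Rintegral => x; rewrite inE => /RplusP x0.
  by rewrite subr0 ger0_norm.
- apply: eq_Rintegral => y; rewrite inE => /RplusP y0.
  rewrite /potential /mean -RintegralZl//; last exact: has_mean_kernel.
    by apply: eq_Rintegral => x _; rewrite -mulrA mulrCA.
  exact: measurable_Rplus.
Qed.

(** * Lower bounds for the energy *)

Lemma potential0_le {R : realType} (p f : R -> R) : tame_density R p ->
  has_mean p f -> (forall x, 0 < x -> ln x <= f x) -> potential p 0 <= mean p f.
Proof.
move=> pd pf hf; apply: (mean_le 0) => //.
- exact: tame_density_ge0.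
- exact: has_mean_kernel.
- move=> x x0 _ xn; rewrite subr0 ger0_norm//; apply: hf.
  by rewrite lt0r xn.
Qed.

(** The kernel bound is a sum of separated terms, so integrating first in [x], then in [y], leaves
    only means. At fixed [y] the diagonal point is discarded by [mean_le]. *)
Lemma interaction_le {R : realType} (c : R) (p f g : R -> R) :
  tame_density R p -> has_mean p f -> has_mean p g ->
  (forall x y, 0 <= x -> 0 <= y -> x != y ->
     ln `|x - y| <= f x + f y - c * (g x * g y)) ->
  mean p (potential p) <= 2 * mean p f - c * mean p g ^+ 2.
Proof.
move=> pd pf pg hfg.
have p0 := tame_density_ge0 _ pd.
have pc k := has_mean_cst _ k pd.
have potle y : 0 <= y ->
    potential p y <= f y + (mean p f + (- (c * mean p g)) * g y).
  move=> y0.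
  have pgy := has_meanZ _ _ (- (c * g y)) pg.
  have -> : f y + (mean p f + (- (c * mean p g)) * g y)
      = mean p (fun x => f x + (cst (f y) x + (- (c * g y)) * g x)).
    rewrite meanD//; last exact: has_meanD.
    by rewrite meanD// meanZ// mean_cst//; lra.
  apply: (mean_le y) => //.
  - exact: has_mean_kernel.
  - by apply: has_meanD => //; exact: has_meanD.
  - move=> x x0 _ xy; apply: le_trans (hfg _ _ x0 y0 xy) _.
    by rewrite /=; lra.
have pgc := has_meanZ _ _ (- (c * mean p g)) pg.
have -> : 2 * mean p f - c * mean p g ^+ 2
    = mean p (fun y => f y + (cst (mean p f) y + (- (c * mean p g)) * g y)).
  rewrite meanD//; last exact: has_meanD.
  by rewrite meanD// meanZ// mean_cst//; lra.
apply: (mean_le 0) => //.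
- exact: has_mean_potential.
- by apply: has_meanD => //; exact: has_meanD.
- by move=> y y0 _ _; exact: potle.
Qed.

(** A large scale [k] gives a small slope, so that the linear term can later be absorbed by the
    first moment in the energy. *)
Lemma ln_le_lin {R : realType} (k x : R) : 0 < k -> 0 < x ->
  ln x <= k^-1 * x + ln k.
Proof.
move=> k0 x0; have := ln_sublinear (divr_gt0 x0 k0).
by rewrite ln_div ?posrE// mulrC; lra.
Qed.

(** Slope [1/(2 beta)] in the external term costs at most half of the first moment, since
    [beta - 1 <= beta]; slope [1/4] in each variable of the interaction costs the other half. Only
    the constants survive. *)
Lemma energy_ge {R : realType} (beta : R) (p : R -> R) : 1 <= beta ->
  tame_density R p ->
  - ((beta - 1) * ln (2 * beta) + ln 4) <= energy beta p.
Proof.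
move=> b1 pd; rewrite energyE//.
have pid := has_mean_id _ pd.
have pc k := has_mean_cst _ k pd.
have b0 : 0 < 2 * beta by lra.
have m0 : 0 <= mean p id.
  by apply: Rintegral_ge0 => x /RplusP x0; rewrite mulr_ge0// (tame_density_ge0 _ pd).
have h0 : potential p 0 <= (2 * beta)^-1 * mean p id + ln (2 * beta).
  rewrite -meanZ// -[X in _ <= _ + X](mean_cst _ _ pd) -meanD//;
    last exact: has_meanZ.
  apply: potential0_le => //; first by apply: has_meanD => //; exact: has_meanZ.
  by move=> x x0; exact: ln_le_lin.
have pZ := has_meanZ _ _ 4^-1 pid.
have h1 : mean p (potential p) <= 2 * (4^-1 * mean p id + ln 4 / 2).
  have := @interaction_le R 0 p (fun x => 4^-1 * id x + cst (ln 4 / 2) x)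
    (cst 0) pd _ (pc _) _.
  rewrite mul0r subr0 meanD// meanZ// mean_cst//; apply; first exact: has_meanD.
  move=> x y x0 y0 xy; rewrite mul0r subr0 /=.
  have xy0 : 0 < `|x - y| by rewrite normr_gt0 subr_eq0.
  have := ln_le_lin 4 _ (ltr0Sn _ 3) xy0.
  have : `|x - y| <= x + y by rewrite (le_trans (ler_normB _ _))// !ger0_norm.
  lra.
have hb : (beta - 1) * ((2 * beta)^-1 * mean p id) <= 2^-1 * mean p id.
  rewrite mulrA ler_wpM2r//.
  by rewrite ler_pdivrMr// mulrA mulVf// mul1r; lra.
have hb2 : (beta - 1) * potential p 0 <=
    (beta - 1) * ((2 * beta)^-1 * mean p id + ln (2 * beta)).
  by rewrite ler_wpM2l// subr_ge0.
lra.
Qed.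

Lemma energy_ge_constrained {R : realType} (beta q rho : R) (p : R -> R) :
  1 <= beta -> 0 <= q <= 1 -> 1 < rho ->
  tame_density_at rho (q * ln rho) p ->
  (1 - q) * (beta - q) * ln rho - (1 + 2 * ln 2) <= energy beta p.
Proof.
move=> b1 /andP[q0 q1] rho1 [pd pr]; rewrite energyE//.
pose L := ln rho; pose u x := ln (1 + rho * x); pose v x := Num.min (u x) L.
have L0 : 0 < L by exact: ln_gt0.
have r0 : 0 < rho by rewrite (lt_trans _ rho1).
have pid := has_mean_id _ pd.
have pc k := has_mean_cst _ k pd.
have u0 x : 0 <= x -> 0 <= u x.
  by move=> x0; apply: ln_ge0; rewrite lerDl mulr_ge0// ltW.
have uL x : 0 < x -> ln x <= u x - L.
  move=> x0; rewrite lerBrDr -lnM ?posrE//.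
  rewrite ler_ln ?posrE ?mulr_gt0// ?addr_gt0// ?mulr_gt0//.
  by rewrite mulrC lerDr.
have mu' : measurable_fun (Rplus R) u.
  apply: measurable_funTS; apply: (@measurableT_comp _ _ _ _ _ _ (@ln R)).
    exact: measurable_ln.
  by apply: measurable_funD => //; exact: measurable_funM.
have ule x : 0 <= x -> u x <= rho * x.
  by move=> x0; apply: le_ln1Dx; rewrite (@lt_le_trans _ _ 0)// mulr_ge0// ltW.
have pu : has_mean p u.
  apply: (has_mean_tame rho) => // x x0; rewrite ger0_norm ?u0//.
  by rewrite (le_trans (ule _ x0))// ler_wpM2l ?(ltW r0)// lerDr.
have v0 x : 0 <= x -> 0 <= v x by move=> x0; rewrite le_min u0// ltW.
have vu x : v x <= u x by rewrite ge_min lexx.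
have vL x : v x <= L by rewrite ge_min lexx orbT.
have pv : has_mean p v.
  apply: (has_mean_tame rho) => //.
    by apply: measurable_minr => //; exact: measurable_cst.
  move=> x x0; rewrite ger0_norm ?v0// (le_trans (vu _))//.
  by rewrite (le_trans (ule _ x0))// ler_wpM2l ?(ltW r0)// lerDr.
have Eu : mean p u = q * L by [].
have hpot : potential p 0 <= q * L - L.
  rewrite -Eu -[X in _ <= _ + X](mean_cst _ _ pd) -meanD//.
  by apply: potential0_le => //; exact: has_meanD.
(* The term [- L] of the kernel bound is split evenly between the two variables to fit the symmetric
   form of [interaction_le]. *)
have hint : mean p (potential p) <= 2 * (q * L - L / 2) - L^-1 * mean p v ^+ 2.
  have -> : q * L - L / 2 = mean p (fun x => u x + cst (- (L / 2)) x).
    by rewrite meanD// mean_cst// Eu.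
  apply: interaction_le => //; first exact: has_meanD.
  (* With [y] the larger point, [ln (y - x) <= ln y <= u y - L], while [v x * v y / L <= u x]
     because [v x <= u x] and [v y <= L]. *)
  have key x y : 0 <= x -> x < y ->
      ln (y - x) <= u x + cst (- (L / 2)) x + (u y + cst (- (L / 2)) y)
        - L^-1 * (v x * v y).
    move=> x0 xy /=; have y0 : 0 < y by exact: le_lt_trans xy.
    have h1 : ln (y - x) <= ln y by rewrite ler_ln ?posrE ?subr_gt0// gerBl.
    have h2 := uL _ y0.
    have h3 : L^-1 * (v x * v y) <= u x.
      rewrite mulrC ler_pdivrMr// ler_pM ?v0// ltW//.
    lra.
  move=> x y x0 y0; rewrite neq_lt => /orP[xy|yx].
    by rewrite distrC gtr0_norm ?subr_gt0//; exact: key.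
  rewrite gtr0_norm ?subr_gt0//; apply: le_trans (key _ _ y0 yx) _.
  by rewrite /=; lra.
pose w x : R := ln (1 + x).
have w0 x : 0 <= x -> 0 <= w x by move=> x0; rewrite ln_ge0// lerDl.
have mw : measurable_fun (Rplus R) w.
  apply: measurable_funTS; apply: (@measurableT_comp _ _ _ _ _ _ (@ln R)).
    exact: measurable_ln.
  exact: measurable_funD.
have pw : has_mean p w.
  apply: (has_mean_tame 1) => // x x0; rewrite ger0_norm ?w0// mul1r.
  by rewrite ltW// ln_sublinear// ltr_wpDr.
(* Slope [1/2] is chosen because [mean p w] enters the final estimate with factor at most 2: the
   first moment absorbs it exactly and [1 + 2 * ln 2] remains. *)
have hw : mean p w <= 2^-1 * mean p id + (2^-1 + ln 2).
  rewrite -meanZ// -[X in _ <= _ + X](mean_cst _ _ pd) -meanD//;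
    last exact: has_meanZ.
  apply: (mean_le 0) => //; first exact: tame_density_ge0.
    by apply: has_meanD => //; exact: has_meanZ.
  move=> x x0 _ _ /=; have x10 : 0 < 1 + x by rewrite ltr_wpDr.
  have := ln_le_lin 2 _ (ltr0Sn _ 1) x10; rewrite /w; lra.
(* The truncation loses at most [w]: from [1 + rho x <= rho (1 + x)] one gets [u x <= L + w x]. *)
have hv : q * L <= mean p v + mean p w.
  rewrite -Eu -meanD//; apply: (mean_le 0) => //.
  - exact: tame_density_ge0.
  - exact: has_meanD.
  - move=> x x0 _ _; rewrite /v; case: (leP (u x) L) => _.
      by rewrite lerDl w0.
    have x10 : 0 < 1 + x by rewrite ltr_wpDr.
    rewrite /u /L /w -lnM ?posrE// ler_ln ?posrE ?mulr_gt0//.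
      by rewrite mulrDr mulr1 lerD2r ltW.
    by rewrite ltr_wpDr// mulr_ge0// ltW.
(* The square is bounded below by its tangent line at [q L], into which [hv] is inserted. *)
have hsq : q * (q * L - 2 * mean p w) <= L^-1 * mean p v ^+ 2.
  rewrite [leRHS]mulrC ler_pdivlMr//.
  have : 0 <= (mean p v - q * L) ^+ 2 by exact: sqr_ge0.
  have : 0 <= 2 * q * L * (mean p v + mean p w - q * L).
    by rewrite mulr_ge0 ?subr_ge0// mulr_ge0 ?(ltW L0)// mulr_ge0.
  lra.
have hqw : q * mean p w <= mean p w.
  rewrite ler_piMl//; apply: Rintegral_ge0 => x /RplusP x0.
  by rewrite mulr_ge0 ?w0// (tame_density_ge0 _ pd).
have hb2 : (beta - 1) * potential p 0 <= (beta - 1) * (q * L - L).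
  by rewrite ler_wpM2l// subr_ge0.
rewrite -/L; lra.
Qed.

(** * Mixtures of uniform densities *)

Definition unif {R : realType} (c d x : R) : R :=
  (d - c)^-1 * (c <= x <= d)%R%:R.

Lemma unif_ge0 {R : realType} (c d x : R) : c < d -> 0 <= unif c d x.
Proof. by move=> cd; rewrite mulr_ge0// invr_ge0 subr_ge0 ltW. Qed.

Lemma unif_gt0_itv {R : realType} (c d x : R) : 0 < unif c d x -> c <= x <= d.
Proof. by rewrite /unif; case: (c <= x <= d)%R => //; rewrite mulr0 ltxx. Qed.

Lemma unifE {R : realType} (c d : R) :
  unif c d = fun x => (d - c)^-1 * \1_(`[c, d]%classic) x.
Proof.
apply/funext => x; rewrite /unif indicE.
have -> // : (x \in `[c, d]%classic) = (c <= x <= d).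
by apply/idP/idP; rewrite inE /= in_itv.
Qed.

Lemma measurable_unif {R : realType} (D : set R) (c d : R) :
  measurable_fun D (unif c d).
Proof.
rewrite unifE; apply: measurable_funTS; apply: measurable_funM => //.
Qed.

Lemma integrable_unif {R : realType} (c d : R) :
  lebesgue_measure.-integrable (Rplus R) (EFin \o unif c d).
Proof.
have i1 : lebesgue_measure.-integrable (Rplus R) (EFin \o \1_(`[c, d]%classic)).
  apply: (integrableS _ _ _ (integrable_indic_itv c d true false)) => //.
  exact: measurable_Rplus.
rewrite unifE; exact: (integrableZl measurable_Rplus (d - c)^-1 i1).
Qed.

Lemma Rintegral_unif {R : realType} (c d : R) : 0 <= c -> c < d ->
  \int[lebesgue_measure]_(x in Rplus R) unif c d x = 1.
Proof.
move=> c0 cd.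
have i1 : lebesgue_measure.-integrable (Rplus R) (EFin \o \1_(`[c, d]%classic)).
  apply: (integrableS _ _ _ (integrable_indic_itv c d true false)) => //.
  exact: measurable_Rplus.
rewrite unifE RintegralZl//; last exact: measurable_Rplus.
rewrite /Rintegral integral_indic//; last exact: measurable_Rplus.
rewrite setIidl; last first.
  by move=> x /=; rewrite in_itv/= => /andP[cx _]; apply/RplusP; exact: le_trans cx.
have E : lebesgue_measure `[c, d]%classic = (d - c)%:E.
  by rewrite lebesgue_measure_itv/= lte_fin cd EFinB.
by rewrite (congr1 fine E) mulVf// gt_eqF// subr_gt0.
Qed.

Lemma integrable_bounded_supp {R : realType} (M : R) (f : R -> R) :
  measurable_fun (Rplus R) f ->
  (forall x, 0 <= x -> `|f x| <= M * (x <= 2)%R%:R) ->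
  lebesgue_measure.-integrable (Rplus R) (EFin \o f).
Proof.
move=> mf fM.
(* The factor 2 cancels the height [1/2] of the uniform density on [[0, 2]]. *)
have iu := integrableZl measurable_Rplus (2 * M) (@integrable_unif R 0 2).
apply: le_integrable iu; first exact: measurable_Rplus.
  exact/measurable_EFinP.
move=> x /RplusP x0; rewrite /= lee_fin (le_trans _ (ler_norm _))//.
rewrite (le_trans (fM _ x0))// /unif x0 subr0 /= le_eqVlt; apply/orP; left.
by apply/eqP; lra.
Qed.

Lemma tame_bounded {R : realType} (M : R) (p : R -> R) :
  measurable_fun (Rplus R) p ->
  (forall x, 0 <= x -> `|p x| <= M) -> (forall x, 2 < x -> p x = 0) ->
  tame R p.
Proof.
move=> mp pM pS.
have M0 : 0 <= M by exact: le_trans (pM 0 (lexx _)).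
have pM1 x : 0 <= x -> `|p x| <= M * (x <= 2)%R%:R.
  move=> x0; have [x2|x2] := leP x 2; first by rewrite mulr1 pM.
  by rewrite pS// normr0 mulr0.
have mnp : measurable_fun (Rplus R) (fun x => `|p x|) by exact: measurableT_comp.
have fin f : (forall x, 0 <= x -> 0 <= f x) ->
    lebesgue_measure.-integrable (Rplus R) (EFin \o f) ->
    (\int[lebesgue_measure]_(x in Rplus R) (f x)%:E < +oo)%E.
  move=> f0 /integrableP[_]; apply: le_lt_trans.
  rewrite le_eqVlt; apply/orP; left; apply/eqP; apply: eq_integral => x.
  by rewrite inE => /RplusP x0; rewrite /= ger0_norm// f0.
split; first exact: (integrable_bounded_supp M).
- apply: fin; first by move=> x x0; rewrite mulr_ge0.
  apply: (integrable_bounded_supp (2 * M)); first exact: measurable_funM.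
  move=> x x0; rewrite normrM normr_id (ger0_norm x0).
  have [x2|x2] := leP x 2; last by rewrite pS// normr0 !mulr0.
  by rewrite mulr1 ler_pM// pM.
- exists 1 => //; apply: fin; first by move=> x x0; exact: powR_ge0.
  have E x : `|p x| `^ (1 + 1) = `|p x| ^+ 2 by rewrite -powR_mulrn.
  apply: (integrable_bounded_supp (M ^+ 2)).
    rewrite (_ : (fun x => _) = fun x => `|p x| ^+ 2); last exact/funext.
    exact: measurable_funX.
  move=> x x0; rewrite E ger0_norm ?exprn_ge0//.
  have [x2|x2] := leP x 2; last by rewrite pS// normr0 mulr0 expr0n.
  by rewrite mulr1 lerXn2r ?nnegrE ?pM.
Qed.

Definition mix {R : realType} (a : R) (p1 p2 : R -> R) (x : R) : R :=
  a * p1 x + (1 - a) * p2 x.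

Lemma mean_mix {R : realType} (a : R) (p1 p2 f : R -> R) :
  has_mean p1 f -> has_mean p2 f ->
  mean (mix a p1 p2) f = a * mean p1 f + (1 - a) * mean p2 f.
Proof.
move=> h1 h2; have mD := @measurable_Rplus R.
rewrite /mean -!RintegralZl// -RintegralD//; last 2 first.
- exact: (integrableZl mD a h1).
- exact: (integrableZl mD (1 - a) h2).
by apply: eq_Rintegral => x _; rewrite /mix; lra.
Qed.

Lemma Rintegral_RplusZl {R : realType} (k : R) (f : R -> R) :
  lebesgue_measure.-integrable (Rplus R) (EFin \o f) ->
  \int[lebesgue_measure]_(x in Rplus R) (k * f x)
  = k * \int[lebesgue_measure]_(x in Rplus R) f x.
Proof. by move=> fi; rewrite RintegralZl//; exact: measurable_Rplus. Qed.

Lemma tame_density_mix {R : realType} (a c1 d1 c2 d2 : R) : 0 <= a <= 1 ->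
  0 <= c1 -> c1 < d1 -> d1 <= 2 -> 0 <= c2 -> c2 < d2 -> d2 <= 2 ->
  tame_density R (mix a (unif c1 d1) (unif c2 d2)).
Proof.
move=> /andP[a0 a1] c10 cd1 d12 c20 cd2 d22.
have mD := @measurable_Rplus R.
have ge0 x : 0 <= mix a (unif c1 d1) (unif c2 d2) x.
  by rewrite addr_ge0// mulr_ge0 ?unif_ge0// subr_ge0.
have le1 (c d x : R) : c < d -> unif c d x <= (d - c)^-1.
  move=> cd; rewrite /unif; case: (c <= x <= d)%R; rewrite ?mulr1// mulr0.
  by rewrite invr_ge0 subr_ge0 ltW.
split => //.
- apply: (tame_bounded ((d1 - c1)^-1 + (d2 - c2)^-1)).
  + by apply: measurable_funD; apply: measurable_funM => //; exact: measurable_unif.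
  + move=> x x0; rewrite ger0_norm//; apply: lerD.
      by rewrite (le_trans _ (le1 _ _ x cd1))// ler_piMl// unif_ge0.
    by rewrite (le_trans _ (le1 _ _ x cd2))// ler_piMl ?unif_ge0//; lra.
  + move=> x x2; have E c d : d <= 2 -> unif c d x = 0.
      by move=> d2'; rewrite /unif [x <= d]leNgt (le_lt_trans d2' x2) andbF mulr0.
    by rewrite /mix !E// !mulr0 addr0.
- rewrite RintegralD//; last 2 first.
  + exact: (integrableZl mD a (integrable_unif _ _)).
  + exact: (integrableZl mD (1 - a) (integrable_unif _ _)).
  rewrite (Rintegral_RplusZl a _ (integrable_unif c1 d1)).
  rewrite (Rintegral_RplusZl (1 - a) _ (integrable_unif c2 d2)).
  by rewrite !Rintegral_unif//; lra.
Qed.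

Lemma tame_density_unif {R : realType} (c d : R) : 0 <= c -> c < d -> d <= 2 ->
  tame_density R (unif c d).
Proof.
move=> c0 cd d2.
have -> : unif c d = mix 1 (unif c d) (unif c d).
  by apply/funext => x; rewrite /mix; lra.
by apply: tame_density_mix => //; rewrite ler01 lexx.
Qed.

(** By [ln_norm_ge], [ln |x - y| >= ln h - 2 sqrt h |x - y|^(-1/2)] with [h = d - c]. The mean of
    [|x - y|^(-1/2)] is at most [5 / sqrt h], whence the loss of 10, uniformly in [y]. *)
Lemma potential_unif_ge {R : realType} (c d y : R) : 0 <= c -> c < d ->
  d - c <= 1 -> d <= 2 -> 0 <= y ->
  ln (d - c) - 10 <= potential (unif c d) y.
Proof.
move=> c0 cd dc1 d2 y0; set h := d - c.
have h0 : 0 < h by rewrite subr_gt0.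
have sh0 : 0 < Num.sqrt h by rewrite sqrtr_gt0.
have ud := tame_density_unif _ _ c0 cd d2.
have mD := @measurable_Rplus R.
have iL := integrableZl mD h^-1 (integrable_local_invsqrt h y).
have iU := integrableZl mD (Num.sqrt h)^-1 (@integrable_unif R c d).
pose g x := h^-1 * local_invsqrt h y x + (Num.sqrt h)^-1 * unif c d x.
have ig : lebesgue_measure.-integrable (Rplus R) (EFin \o g).
  exact: (integrableD mD iL iU).
(* Within distance [h] of [y] the density is at most [1/h]; beyond it the kernel is at most
   [1 / sqrt h]. These parts contribute 4 and 1 to the constant 5. *)
have le x : unif c d x * invsqrt y x <= g x.
  rewrite /g /local_invsqrt; have [xy|xy] := leP `|x - y| h.
    rewrite mul1r; apply: (@le_trans _ _ (h^-1 * invsqrt y x)).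
      rewrite ler_wpM2r ?invsqrt_ge0// /unif ler_piMr ?invr_ge0 ?(ltW h0)//.
      by case: (c <= x <= d)%R.
    by rewrite lerDl mulr_ge0 ?unif_ge0// invr_ge0 ltW.
  rewrite mul0r mulr0 add0r mulrC ler_wpM2r ?unif_ge0// /invsqrt.
  by rewrite lef_pV2 ?posrE ?sqrtr_gt0// ?(lt_trans h0 xy)// ler_wsqrtr// ltW.
have ui : has_mean (unif c d) (invsqrt y).
  apply: (has_mean_le _ _ g) => //;
    [exact: measurable_unif|exact: measurable_invsqrt|].
  move=> x _; have := mulr_ge0 (unif_ge0 c d x cd) (invsqrt_ge0 y x).
  by move=> /ger0_norm ->.
have mi : Num.sqrt h * mean (unif c d) (invsqrt y) <= 5.
  rewrite mulrC -ler_pdivlMr//.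
  apply: (@le_trans _ _ (\int[lebesgue_measure]_(x in Rplus R) g x)).
    by apply: le_Rintegral => // x _; exact: le.
  rewrite /g RintegralD//.
  rewrite (Rintegral_RplusZl _ _ (integrable_unif c d)).
  rewrite (Rintegral_RplusZl _ _ (integrable_local_invsqrt h y)).
  rewrite Rintegral_unif// mulr1.
  have hi : 0 <= h^-1 by rewrite invr_ge0 ltW.
  have := ler_wpM2l hi (Rintegral_local_invsqrt h y).
  have -> : h^-1 * (4 * Num.sqrt h) = 4 * (Num.sqrt h)^-1.
    rewrite mulrCA; congr (_ * _); rewrite -{1}(sqr_sqrtr (ltW h0)) expr2 invfM.
    by rewrite -mulrA mulVf ?mulr1// gt_eqF.
  lra.
have um := has_meanZ _ _ (- (2 * Num.sqrt h)) ui.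
have uc := has_mean_cst _ (ln h) ud.
apply: (@le_trans _ _ (mean (unif c d)
    (fun x => cst (ln h) x + - (2 * Num.sqrt h) * invsqrt y x))).
  by rewrite meanD// meanZ// mean_cst//; lra.
apply: (mean_le y).
- exact: tame_density_ge0.
- exact: has_meanD.
- exact: has_mean_kernel.
- move=> x x0 _ _; rewrite /= mulNr; apply: ln_norm_ge => //.
  by rewrite h0.
Qed.

Lemma mean_unif_le {R : realType} (c d k : R) (f : R -> R) :
  0 <= c -> c < d -> d <= 2 -> has_mean (unif c d) f ->
  (forall x, c <= x <= d -> f x <= k) -> mean (unif c d) f <= k.
Proof.
move=> c0 cd d2 hf fk; have ud := tame_density_unif _ _ c0 cd d2.
rewrite -[leRHS](mean_cst _ _ ud); apply: (mean_le 0) => //.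
- exact: tame_density_ge0.
- exact: has_mean_cst.
- by move=> x _ /unif_gt0_itv cxd _; exact: fk.
Qed.

Lemma mean_unif_ge {R : realType} (c d k : R) (f : R -> R) :
  0 <= c -> c < d -> d <= 2 -> has_mean (unif c d) f ->
  (forall x, c <= x <= d -> k <= f x) -> k <= mean (unif c d) f.
Proof.
move=> c0 cd d2 hf fk; have ud := tame_density_unif _ _ c0 cd d2.
rewrite -[leLHS](mean_cst _ _ ud); apply: (mean_le 0) => //.
- exact: tame_density_ge0.
- exact: has_mean_cst.
- by move=> x _ /unif_gt0_itv cxd _; exact: fk.
Qed.

(** Up to constants, the external term costs [(beta - 1) (1 - a) L], and the interaction
    [(1 - a)^2 L], coming from pairs of points both at scale [1 / rho]. The sum is
    [(1 - a) (beta - a) L]. *)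
Lemma energy_mix_le {R : realType} (beta a rho : R) :
  1 <= beta -> 0 <= a <= 1 -> 2 <= rho ->
  energy beta (mix a (unif 1 2) (unif 0 rho^-1))
  <= (1 - a) * (beta - a) * ln rho + (2 + 10 * beta).
Proof.
move=> b1 a01 r2; have /andP[a0 a1] := a01.
have r0 : 0 < rho by lra.
have ri0 : 0 < rho^-1 by rewrite invr_gt0.
have ri2 : rho^-1 <= 2^-1 by rewrite lef_pV2 ?posrE.
have h1 : (1 : R) < 2 by lra.
have h22 : rho^-1 <= 2 by lra.
set L := ln rho; have L0 : 0 <= L by apply: ln_ge0; lra.
set p := mix _ _ _.
have u1 := @tame_density_unif R 1 2 ler01 h1 (lexx _).
have u2 := tame_density_unif 0 _ (lexx _) ri0 h22.
have pd : tame_density R p by apply: tame_density_mix.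
rewrite energyE//.
have hid : mean p id <= 2.
  rewrite mean_mix; [|exact: has_mean_id|exact: has_mean_id].
  have m1 : mean (unif 1 2) id <= 2 :> R.
    by apply: mean_unif_le => //; [exact: has_mean_id|move=> x /andP[]].
  have m2 : mean (unif 0 rho^-1) id <= 2 :> R.
    apply: mean_unif_le => //; first exact: has_mean_id.
    by move=> x /andP[_] /le_trans; apply.
  have := ler_wpM2l a0 m1.
  have : (1 - a) * mean (unif 0 rho^-1) id <= (1 - a) * 2.
    by rewrite ler_wpM2l// subr_ge0.
  lra.
have potE y : 0 <= y -> potential p y
    = a * potential (unif 1 2) y + (1 - a) * potential (unif 0 rho^-1) y.
  by move=> y0; apply: mean_mix; exact: has_mean_kernel.
have g1 y : 0 <= y -> - 10 <= potential (unif 1 2) y :> R.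
  move=> y0; have := potential_unif_ge 1 2 y ler01 h1.
  have -> : 2 - 1 = 1 :> R by lra.
  by rewrite ln1 add0r; apply.
have g2 y : 0 <= y -> - L - 10 <= potential (unif 0 rho^-1) y.
  move=> y0; have := potential_unif_ge 0 rho^-1 y (lexx _) ri0.
  by rewrite subr0 lnV ?posrE//; apply => //; lra.
have ln2 : ln 2 < 2 :> R by apply: ln_sublinear.
(* Points [y >= 1] lie at distance at least [1/2] from the small interval, so no [L] is lost
   there. *)
have g3 y : 1 <= y -> - 10 <= potential (unif 0 rho^-1) y.
  move=> y1; have y0 : 0 <= y by lra.
  apply: mean_unif_ge => //; first exact: has_mean_kernel.
  move=> x /andP[x0 xr]; have xy : 2^-1 <= `|x - y|.
    by rewrite distrC ger0_norm; lra.
  apply: (@le_trans _ _ (ln 2^-1)); first by rewrite lnV ?posrE//; lra.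
  by rewrite ler_ln ?posrE//; lra.
have ha (t k : R) : k <= t -> a * k <= a * t by exact: ler_wpM2l.
have hb (t k : R) : k <= t -> (1 - a) * k <= (1 - a) * t.
  by apply: ler_wpM2l; rewrite subr_ge0.
have hp0 : - 10 - (1 - a) * L <= potential p 0.
  rewrite potE//; have := ha _ _ (g1 _ (lexx 0)); have := hb _ _ (g2 _ (lexx 0)).
  lra.
(* This indicator charges the loss [(1 - a) L] of the potential only to points below 1, whose total
   mass is at most [1 - a]. *)
pose s (y : R) : R := (y < 1)%R%:R.
have ms : measurable_fun (Rplus R) s.
  have -> : s = \1_(`]-oo, 1[%classic).
    apply/funext => y; rewrite /s indicE.
    by have -> // : (y \in `]-oo, 1[%classic) = (y < 1);
      apply/idP/idP; rewrite inE /= in_itv.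
  exact: measurable_indic.
have hs q : tame_density R q -> has_mean q s.
  move=> qd; apply: (has_mean_tame 1) => // x x0; rewrite /s mul1r.
  by case: (x < 1)%R; rewrite ?normr1 ?normr0; lra.
have ms1 : mean (unif 1 2) s <= 0.
  apply: mean_unif_le => //; first exact: hs.
  by move=> x /andP[x1 _]; rewrite /s ltNge x1.
have ms2 : mean (unif 0 rho^-1) s <= 1.
  apply: mean_unif_le => //; first exact: hs.
  by move=> x _; rewrite /s; case: (x < 1)%R.
have mps : mean p s <= 1 - a.
  rewrite mean_mix; [|exact: hs|exact: hs].
  by have := ha _ _ ms1; have := hb _ _ ms2; lra.
have hpp : - 10 - (1 - a) * L * (1 - a) <= mean p (potential p).
  apply: (@le_trans _ _ (mean p (fun y => cst (- 10) y + (- ((1 - a) * L)) * s y))).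
    rewrite meanD; [|exact: has_mean_cst|exact/has_meanZ/hs].
    rewrite meanZ ?mean_cst//; last exact: hs.
    have : (1 - a) * L * mean p s <= (1 - a) * L * (1 - a).
      by rewrite ler_wpM2l// mulr_ge0// subr_ge0.
    lra.
  apply: (mean_le 0).
  - exact: tame_density_ge0.
  - by apply: has_meanD; [exact: has_mean_cst|exact/has_meanZ/hs].
  - exact: has_mean_potential.
  - move=> y y0 _ _; rewrite /= potE// /s; have [y1|y1] := ltP y 1.
      rewrite mulr1.
      have := ha _ _ (g1 _ y0); have := hb _ _ (g2 _ y0); lra.
    rewrite mulr0 addr0.
    have := ha _ _ (g1 _ y0); have := hb _ _ (g3 _ y1); lra.
have hb2 : (beta - 1) * (- 10 - (1 - a) * L) <= (beta - 1) * potential p 0.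
  by rewrite ler_wpM2l// subr_ge0.
lra.
Qed.

(** The constraint is the linear equation [a A + (1 - a) B = q L], where [A = L + O(1)] and
    [B = O(1)] are the values of the two components. The solution lies in [[0, 1]] because
    [B <= 1 <= q L <= L <= A]. *)
Lemma constrained_mix {R : realType} (q rho : R) :
  0 < q < 1 -> 2 <= rho -> 2 <= ln rho -> q^-1 <= ln rho ->
  exists a : R, [/\ 0 <= a <= 1, `|a - q| * ln rho <= 8 &
    tame_density_at rho (q * ln rho) (mix a (unif 1 2) (unif 0 rho^-1))].
Proof.
move=> /andP[q0 q1] r2 L2 Lq.
have r0 : 0 < rho by lra.
have ri0 : 0 < rho^-1 by rewrite invr_gt0.
have ri2 : rho^-1 <= 2^-1 by rewrite lef_pV2 ?posrE.
have h1 : (1 : R) < 2 by lra.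
have h22 : rho^-1 <= 2 by lra.
have u1 := @tame_density_unif R 1 2 ler01 h1 (lexx _).
have u2 := tame_density_unif 0 _ (lexx _) ri0 h22.
set L := ln rho; pose u x := ln (1 + rho * x).
have mu' : measurable_fun (Rplus R) u.
  apply: measurable_funTS; apply: (@measurableT_comp _ _ _ _ _ _ (@ln R)).
    exact: measurable_ln.
  by apply: measurable_funD => //; exact: measurable_funM.
have ule x : 0 <= x -> 0 <= u x <= rho * x.
  move=> x0; have rx0 : 0 <= rho * x by rewrite mulr_ge0// ltW.
  by rewrite ln_ge0 ?lerDl//= le_ln1Dx//; lra.
have hu p : tame_density R p -> has_mean p u.
  move=> pd; apply: (has_mean_tame rho) => // x x0.
  have /andP[? ?] := ule _ x0.
  by rewrite ger0_norm//; lra.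
pose A := mean (unif 1 2) u; pose B := mean (unif 0 rho^-1) u.
have A1 : L <= A.
  apply: mean_unif_ge => //; first exact: hu.
  move=> x /andP[x1 x2]; rewrite /L /u ler_ln ?posrE//.
    by have := ler_wpM2l (ltW r0) x1; lra.
  by have := ler_wpM2l (ltW r0) x1; lra.
have A2 : A <= L + 3.
  apply: mean_unif_le => //; first exact: hu.
  move=> x /andP[x1 x2]; apply: (@le_trans _ _ (ln (rho * 3))).
    rewrite /u ler_ln ?posrE ?mulr_gt0//.
      by have := ler_wpM2l (ltW r0) x2; lra.
    by have := ler_wpM2l (ltW r0) x1; lra.
  by rewrite lnM ?posrE// lerD2l ltW// ln_sublinear.
have B1 : 0 <= B.
  apply: mean_unif_ge => //; first exact: hu.
  by move=> x /andP[x0 _]; case/andP: (ule _ x0).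
have B2 : B <= 1.
  apply: mean_unif_le => //; first exact: hu.
  move=> x /andP[x0 x1]; have /andP[_ /le_trans] := ule _ x0; apply.
  by rewrite mulrC -ler_pdivlMr// div1r.
have AB : 0 < A - B by rewrite /L in A1 *; lra.
have qL : 1 <= q * L by rewrite mulrC -ler_pdivrMr// div1r.
have qLL : q * L <= L by rewrite ler_piMl ?(ltW q1)// /L; lra.
pose a := (q * L - B) / (A - B).
have aE : a * (A - B) = q * L - B by rewrite mulfVK// gt_eqF.
have a01 : 0 <= a <= 1.
  by rewrite divr_ge0 ?(ltW AB)//= ?ler_pdivrMr ?mul1r//; lra.
exists a; split => //.
(* Together with [L <= 2 (A - B)], a consequence of [L >= 2] and [B <= 1], this gives the bound
   8. *)
- have num : `|(a - q) * (A - B)| <= 4.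
    have -> : (a - q) * (A - B) = q * (L - A) - (1 - q) * B by lra.
    have c1 : q * (A - L) <= A - L by rewrite ler_piMl ?(ltW q1)// subr_ge0.
    have c0 : 0 <= q * (A - L) by rewrite mulr_ge0 ?(ltW q0)// subr_ge0.
    have c2 : (1 - q) * B <= B by rewrite ler_piMl//; lra.
    have c3 : 0 <= (1 - q) * B by rewrite mulr_ge0//; lra.
    by rewrite ler_norml; apply/andP; split; lra.
  rewrite normrM (gtr0_norm AB) in num.
  have : `|a - q| * L <= `|a - q| * (2 * (A - B)).
    by rewrite ler_wpM2l//; move: L2; rewrite -/L; lra.
  lra.
- split; first exact: tame_density_mix.
  have -> : q * ln rho = a * A + (1 - a) * B by rewrite -/L; lra.
  by rewrite -mean_mix//; exact: hu.
Qed.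

(** * Finiteness of [E0] and two-sided bounds for [E1] *)

Lemma E0_fin_num {R : realType} (beta : R) : 1 <= beta -> E0 beta \is a fin_num.
Proof.
move=> b1; rewrite fin_real//; apply/andP; split.
  apply: (@lt_le_trans _ _ (- ((beta - 1) * ln (2 * beta) + ln 4))%:E).
    exact: ltNyr.
  by apply: le_ereal_inf_tmp => _ [p pd <-]; rewrite lee_fin energy_ge.
apply: (@le_lt_trans _ _ (energy beta (unif 1 2))%:E); last exact: ltry.
apply: ereal_inf_lbound; exists (unif 1 2) => //.
by apply: tame_density_unif => //; lra.
Qed.

Lemma E1_bounds {R : realType} (beta q : R) : 1 <= beta -> 0 < q < 1 ->
  exists C M : R, forall rho, 2 <= rho -> M <= ln rho ->
    (((1 - q) * (beta - q) * ln rho - C)%:E <= E1 beta rho (q * ln rho)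
     <= ((1 - q) * (beta - q) * ln rho + C)%:E)%E.
Proof.
move=> b1 q01; have /andP[q0 q1] := q01.
have ln20 : 0 <= ln 2 :> R by apply: ln_ge0; lra.
(* The summands are the errors of the lower bound, of the mixture energy and of replacing [a] by
   [q]. The threshold exceeds both 2 and [q^-1], as [constrained_mix] demands. *)
exists (1 + 2 * ln 2 + (2 + 10 * beta) + 8 * (1 + beta)), (2 + q^-1).
move=> rho r2 Lr.
have qi : 0 < q^-1 by rewrite invr_gt0.
apply/andP; split.
  apply: le_ereal_inf_tmp => _ [p pd <-]; rewrite lee_fin.
  apply: le_trans (energy_ge_constrained _ _ _ _ b1 _ _ pd); [lra| |lra].
  by rewrite !ltW.
have [||a [a01 aq ad]] := constrained_mix _ _ q01 r2; [lra|lra|].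
apply: ge_ereal_inf; exists (energy beta (mix a (unif 1 2) (unif 0 rho^-1)))%:E.
  by exists (mix a (unif 1 2) (unif 0 rho^-1)).
rewrite lee_fin (le_trans (energy_mix_le _ _ _ b1 a01 r2))//.
have /andP[a0 a1] := a01.
(* The left side is exactly [(1 - a) (beta - a) L - (1 - q) (beta - q) L], with [L = ln rho]. *)
have : (q - a) * (1 + beta - a - q) * ln rho <= 8 * (1 + beta).
  apply: le_trans (ler_norm _) _; rewrite !normrM distrC.
  rewrite (ger0_norm (_ : 0 <= ln rho)); last lra.
  rewrite mulrAC; apply: ler_pM => //; first by rewrite mulr_ge0//; lra.
  by rewrite ler_norml; apply/andP; split; lra.
lra.
Qed.

(** * The asymptotics *)

Theorem mainTheorem5 (R : realType) (beta q : R)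
  (hbeta : 1 <= beta) (hq0 : 0 < q) (hq1 : q < 1) :
  ((E1 beta rho (q * ln rho) - E0 beta)
     * (((1 - q) * (beta - q) * ln rho)^-1)%:E)%E
    @[rho --> +oo] --> (1%:E : \bar R).
Proof.
have q01 : 0 < q < 1 by rewrite hq0.
have [C [M hE1]] := E1_bounds _ _ hbeta q01.
have /fineK E0E := E0_fin_num _ hbeta.
set e0 := fine (E0 beta) in E0E.
set k := (1 - q) * (beta - q).
have k0 : 0 < k by rewrite mulr_gt0// subr_gt0//; lra.
pose K := `|C| + `|e0|.
have K0 : 0 <= K by rewrite addr_ge0.
(* For large [rho] the extended-real quotient is a real number [t]. Its numerator differs from
   [k * ln rho] by at most [K], hence [t = 1 + O(1 / ln rho)]. *)
have bound rho : 2 <= rho -> M <= ln rho -> 0 < ln rho -> exists2 t : R,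
    ((E1 beta rho (q * ln rho) - E0 beta) * ((k * ln rho)^-1)%:E = t%:E)%E &
    `|1 - t| <= K / (k * ln rho).
  move=> r2 Mr L0; have /andP[lo hi] := hE1 _ r2 Mr.
  have kL : 0 < k * ln rho by rewrite mulr_gt0.
  have fE1 : E1 beta rho (q * ln rho) \is a fin_num.
    rewrite fin_real// (lt_le_trans _ lo) ?ltNyr//=.
    by rewrite (le_lt_trans hi) ?ltry.
  move: lo hi; rewrite -(fineK fE1) !lee_fin -/k; set e1 := fine _ => lo hi.
  exists ((e1 - e0) / (k * ln rho)); first by rewrite -E0E -EFinB -EFinM.
  have -> : 1 - (e1 - e0) / (k * ln rho) = (k * ln rho - (e1 - e0)) / (k * ln rho).
    by rewrite [RHS]mulrBl divff// gt_eqF.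
  rewrite normrM normfV (gtr0_norm kL) ler_pM2r ?invr_gt0//.
  have := ler_norm C; have := ler_norm e0; have := ler_norm (- e0).
  rewrite normrN /K ler_norml => ? ? ?; apply/andP; split; lra.
have large N : \forall rho \near +oo, N <= ln rho :> R.
  move: (@nbhs_pinfty_ge R (expR N) (num_real _)).
  apply: filterS => rho hr.
  by rewrite -[leLHS]expRK ler_ln// posrE ?(lt_le_trans _ hr) ?expR_gt0.
have big : \forall rho \near +oo, [/\ 2 <= rho, M <= ln rho & 1 <= ln rho :> R].
  move: (@nbhs_pinfty_ge R 2 (num_real _)) (large M) (large 1).
  by apply: filterS3 => rho.
apply/fine_cvgP; split.
  move: big; apply: filterS => rho [r2 Mr L1].
  by have [t -> _] := bound _ r2 Mr (lt_le_trans ltr01 L1).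
apply/cvgrPdist_le => eps eps0.
(* This threshold on [ln rho] is precisely what makes [K / (k * ln rho) <= eps]. *)
move: big (large (K / (eps * k))); apply: filterS2 => rho [r2 Mr L1] KL.
have L0 := lt_le_trans ltr01 L1.
have [t /= -> /= /le_trans] := bound _ r2 Mr L0; apply.
have kL : 0 < k * ln rho by exact: mulr_gt0.
have ek : 0 < eps * k by exact: mulr_gt0.
by move: KL; rewrite !ler_pdivrMr// mulrC -mulrA.
Qed.
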